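(* Assume $K$ has nonempty interior and let $d$ be the maximum degree of $f_1,\ldots,f_m$. Define $$\mathcal V=\{v=(v_1,\ldots,v_m)\in\mathbb R^m:\ \exists\, y\in\mathscr R_d(K)\text{ with } y_0=1 \text{ and } v_i>\langle f_i,y\rangle \ (i=1,\ldots,m)\}.$$ Then the interior of $\mathrm{conv}(\mathcal U)$ equals $\mathcal V$. Moreover, if $\mathcal U$ is convex, then a vector $v\in f(K)$ is a weakly Pareto value if and only if $v$ belongs to the boundary of the closure of $\mathcal V$.
   Context: Let $f_1,\ldots,f_m,c_i$ ($i\in\mathcal E\cup\mathcal I$) be real polynomials in $x\in\mathbb R^n$, $\mathcal E,\mathcal I$ disjoint finite index sets, and $K=\{x: c_i(x)=0\ (i\in\mathcal E),\ c_j(x)\ge0\ (j\in\mathcal I)\}$; $f=(f_1,\ldots,f_m)$, $\mathcal U=f(K)+\mathbb R^m_+=\{u: u_i\ge f_i(x)\ \forall i \text{ for some } x\in K\}$. A point $x^*\in K$ is weakly Pareto if no $x\in K$ has $f_i(x)<f_i(x^* )$ for all $i$; $v$ is a weakly Pareto value if $v=f(x^* )$ for a weakly Pareto point $x^*$. For $d\in\mathbb N$, $\mathbb N^n_d=\{\alpha\in\mathbb N^n:|\alpha|\le d\}$; a vector $y=(y_\alpha)_{\alpha\in\mathbb N^n_d}$ is a truncated multi-sequence, and for $p=\sum_\alpha p_\alpha x^\alpha$ of degree $\le d$, $\langle p,y\rangle=\sum_\alpha p_\alpha y_\alpha$; $y_0$ denotes the entry with $\alpha=0$. The moment cone is $\mathscr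 R_d(K)=\{y\in\mathbb R^{\mathbb N^n_d}: \exists$ a Borel measure $\mu$ with support in $K$ and $y_\alpha=\int x^\alpha d\mu$ for all $\alpha\in\mathbb N^n_d\}$. *)

(* Defs.v *)
From HB Require Import structures.
From mathcomp Require Import all_boot all_order all_algebra.
From mathcomp Require Import all_classical all_reals all_analysis.
From mathcomp Require mpoly.

Set Implicit Arguments.
Unset Strict Implicit.
Unset Printing Implicit Defensive.

Import Order.TTheory GRing.Theory Num.Theory.
Import numFieldNormedType.Exports.
Local Open Scope classical_set_scope.
Local Open Scope ring_scope.

Notation poly n R := (mpoly.mpoly n R).
Notation monom n := (mpoly.multinom n).

Definition peval {R : realType} {n : nat} (p : poly n R) (x : 'rV[R]_n) : R :=
  mpoly.meval (fun i => x ord0 i) p.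

Definition mono {R : realType} {n : nat} (a : monom n) (x : 'rV[R]_n) : R :=
  peval (mpoly.mpolyX R a) x.

(* total degree of a polynomial (0 for the zero polynomial) *)
Definition pdeg {R : realType} {n : nat} (p : poly n R) : nat :=
  (\max_(a <- mpoly.msupp p) mpoly.mdeg a)%N.

Definition maxdeg {R : realType} {n m : nat} (f : 'I_m -> poly n R) : nat :=
  (\max_(i < m) pdeg (f i))%N.

Definition pairing {R : realType} {n : nat} (p : poly n R) (y : monom n -> R) : R :=
  \sum_(a <- mpoly.msupp p) mpoly.mcoeff a p * y a.

Definition Kset {R : realType} {n nE nI : nat}
  (cE : 'I_nE -> poly n R) (cI : 'I_nI -> poly n R) : set 'rV[R]_n :=
  [set x | (forall i, peval (cE i) x = 0) /\ (forall j, 0 <= peval (cI j) x)].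

Definition fimage {R : realType} {n m : nat} (K : set 'rV[R]_n)
  (f : 'I_m -> poly n R) : set 'rV[R]_m :=
  [set v | exists2 x, K x & v = \row_i peval (f i) x].

(* U = f(K) + R^m_+ *)
Definition Uset {R : realType} {n m : nat} (K : set 'rV[R]_n)
  (f : 'I_m -> poly n R) : set 'rV[R]_m :=
  [set u | exists2 x, K x & forall i, peval (f i) x <= u ord0 i].

Definition BorelRn (R : realType) (n : nat) := g_sigma_algebraType (@open 'rV[R]_n).

Definition msupport {R : realType} {n : nat}
  (mu : {measure set (BorelRn R n) -> \bar R}) : set 'rV[R]_n :=
  [set x | forall B : set 'rV[R]_n, open B -> B x -> (0 < mu B)%E].

(* y (restricted to |alpha| <= d) lies in the moment cone R_d(K):
   y_alpha = int x^alpha dmu for all |alpha| <= d, with supp mu in K *)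
Definition in_moment_cone {R : realType} {n : nat} (K : set 'rV[R]_n) (d : nat)
  (y : monom n -> R) : Prop :=
  exists mu : {measure set (BorelRn R n) -> \bar R},
    msupport mu `<=` K /\
    forall a : monom n, (mpoly.mdeg a <= d)%N ->
      mu.-integrable setT (fun x : BorelRn R n => (mono a x)%:E) /\
      (y a)%:E = (\int[mu]_(x in setT) (mono a x)%:E)%E.

Definition Vset {R : realType} {n m : nat} (K : set 'rV[R]_n)
  (f : 'I_m -> poly n R) : set 'rV[R]_m :=
  [set v | exists y : monom n -> R,
     in_moment_cone K (maxdeg f) y /\ y (@mpoly.mnm0 n) = 1 /\
     forall i, pairing (f i) y < v ord0 i].

Definition convhull {R : realType} {m : nat} (A : set 'rV[R]_m) : set 'rV[R]_m :=
  [set z | exists k (w : 'I_k -> R) (p : 'I_k -> 'rV[R]_m),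
     (forall j, 0 <= w j) /\ \sum_(j < k) w j = 1 /\ (forall j, A (p j)) /\
     z = \sum_(j < k) w j *: p j].

Definition is_convex {R : realType} {m : nat} (A : set 'rV[R]_m) : Prop :=
  forall a b t, A a -> A b -> 0 <= t -> t <= 1 -> A (t *: a + (1 - t) *: b).

Definition boundary {R : realType} {m : nat} (A : set 'rV[R]_m) : set 'rV[R]_m :=
  closure A `\` interior A.

Definition weakly_pareto_point {R : realType} {n m : nat} (K : set 'rV[R]_n)
  (f : 'I_m -> poly n R) (xs : 'rV[R]_n) : Prop :=
  K xs /\ ~ (exists2 x, K x & forall i, peval (f i) x < peval (f i) xs).

Definition weakly_pareto_value {R : realType} {n m : nat} (K : set 'rV[R]_n)
  (f : 'I_m -> poly n R) (v : 'rV[R]_m) : Prop :=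
  exists xs, weakly_pareto_point K f xs /\ v = \row_i peval (f i) xs.

(* Main.v *)
(** A point of the interior of [conv U] dominates strictly a finite convex
    combination of values of [f] on [K]; the corresponding atomic measure puts it
    in [V].  Conversely, a point of [V] outside [conv U] could be separated from
    this convex, upward closed set by a nonnegative functional, and integrating
    the resulting inequality on [K] against the representing measure (which
    gives no mass to the complement of [K], as R^n is second countable) is
    absurd.  When [U] is convex, [V] is thus the interior of [U], and moving
    along the diagonal direction (1, ..., 1) translates weak Pareto optimality
    into membership in the boundary. *)

Require Import Defs.
From HB Require Import structures.
From mathcomp Require Import all_boot all_order all_algebra.
From mathcomp Require Import all_classical all_reals all_analysis.
From mathcomp Require Import measurable_realfun.
From mathcomp Require mpoly.
From mathcomp Require Import ring lra.
Import Order.TTheory GRing.Theory Num.Theory.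
Import numFieldNormedType.Exports.
Local Open Scope classical_set_scope.
Local Open Scope ring_scope.

(** * Coordinatewise balls, and topology of polynomial sets *)

Lemma ball_rVP (R : realType) (n : nat) (x y : 'rV[R]_n) (e : R) :
  0 < e -> ball x e y <-> forall i, `|x ord0 i - y ord0 i| < e.
Proof.
move=> e0; split => [[_ xy] i|xy]; first exact: xy.
by split=> // i j; rewrite (ord1 i); exact: xy.
Qed.

Lemma uniform_gap (R : realType) (m : nat) (a b : 'I_m -> R) :
  (forall i, a i < b i) -> exists2 e, 0 < e & forall i, a i + e < b i.
Proof.
(* Half of the smallest gap; the default 1 keeps it positive when [m = 0]. *)
move=> ab; exists (\big[Num.min/1]_i ((b i - a i) / 2)).
  by apply: lt_bigmin => // i _; have := ab i; lra.
move=> i; have : \big[Num.min/1]_j ((b j - a j) / 2) <= (b i - a i) / 2.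
  exact: bigmin_le_cond.
by have := ab i; lra.
Qed.

Lemma continuous_peval (R : realType) (n : nat) (p : mpoly.mpoly n R) :
  continuous (peval p : 'rV[R]_n -> R).
Proof.
rewrite /peval; under eq_fun do rewrite mpoly.mevalE.
apply: continuous_big => [|a _]; first exact: add_continuous.
move=> x; apply: continuousM; first exact: cst_continuous.
move: x; apply: continuous_big => [|i _]; first exact: mul_continuous.
move=> x; exact: (continuous_comp (@coord_continuous R _ _ ord0 i x)
  (@exprn_continuous R (mpoly.fun_of_multinom a i) (x ord0 i))).
Qed.

Lemma closed_Kset (R : realType) (n nE nI : nat)
    (cE : 'I_nE -> mpoly.mpoly n R) (cI : 'I_nI -> mpoly.mpoly n R) :
  closed (Kset cE cI).
Proof.
have -> : Kset cE cI = (\bigcap_i (peval (cE i) @^-1` [set 0])) `&`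
    (\bigcap_j (peval (cI j) @^-1` [set t | 0 <= t])).
  apply/seteqP; split=> [x [xE xI]|x [xE xI]]; split.
  - by move=> i _; exact: xE.
  - by move=> j _; exact: xI.
  - by move=> i; exact: xE.
  - by move=> j; exact: xI.
apply: closedI; apply: closed_bigI => i _.
  by apply: preimage_closed; [move=> ? _; exact: continuous_peval|exact: closed_eq].
by apply: preimage_closed; [move=> ? _; exact: continuous_peval|exact: closed_ge].
Qed.

(** * Borel measures on R^n: support and integration of polynomials *)

Lemma measurable_fun_continuous (R : realType) (n : nat) (f : 'rV[R]_n -> R) :
  continuous f -> measurable_fun setT (f : BorelRn R n -> R).
Proof.
move=> cf; apply: (measurability _ (RGenOInfty.measurableE R)).
move=> /= _ [_ [a ->]] <-; rewrite setTI; apply: sub_sigma_algebra.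
by move/continuousP : cf; apply; exact: interval_open.
Qed.

Lemma rational_ball (R : realType) (n : nat) (B : set 'rV[R]_n) (x : 'rV[R]_n) :
  open B -> B x -> exists (q : 'rV[rat]_n) (k : nat),
    ball (map_mx ratr q : 'rV[R]_n) k.+1%:R^-1 x /\
    ball (map_mx ratr q : 'rV[R]_n) k.+1%:R^-1 `<=` B.
Proof.
rewrite openE => oB /oB /nbhs_ballP[e /= e0 eB].
have e20 : 0 < e / 2 by lra.
(* A ball of radius below [e / 2] that contains [x] lies within distance [e] of [x]. *)
have [k ke] : exists k : nat, k.+1%:R^-1 < e / 2.
  have [k _ /(_ k (leqnn k)) /= ke] := near_infty_natSinv_lt (PosNum e20).
  by exists k.
have k0 : 0 < k.+1%:R^-1 :> R by rewrite invr_gt0.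
suff [q qE] : exists q : 'rV[rat]_n,
    forall i, `|ratr (q ord0 i) - x ord0 i| < k.+1%:R^-1.
  exists q, k; split; first by apply/ball_rVP => // i; rewrite mxE.
  move=> y /ball_rVP-/(_ k0) qy; apply: eB; apply/ball_rVP => // i.
  have := qy i; have := qE i; rewrite mxE.
  move: (k.+1%:R^-1 : R) ke => r re.
  by rewrite !ltr_norml => /andP[? ?] /andP[? ?]; apply/andP; split; lra.
move: (k.+1%:R^-1 : R) k0 => r r0.
have qE i : exists q : rat, `|ratr q - x ord0 i| < r.
  have [|q] := @rat_in_itvoo R (x ord0 i - r) (x ord0 i + r); first by lra.
  rewrite in_itv /= => /andP[? ?]; exists q.
  by rewrite ltr_norml; apply/andP; split; lra.
exists (\row_i projT1 (cid (qE i))) => i.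
by rewrite mxE; exact: (projT2 (cid (qE i))).
Qed.

(** Each point outside [K] has a null open neighbourhood, hence lies in a null ball with rational
    centre and radius [1 / (k + 1)]; there are only countably many such balls. *)
Lemma measure_setC_msupport (R : realType) (n : nat)
    (mu : {measure set (BorelRn R n) -> \bar R}) (K : set 'rV[R]_n) :
  closed K -> msupport mu `<=` K -> mu (~` K) = 0%E.
Proof.
move=> clK suppK.
have oKC : open (~` K) by exact: closed_openC.
pose b (qk : 'rV[rat]_n * nat) : set (BorelRn R n) :=
  ball (map_mx ratr qk.1 : 'rV[R]_n) qk.2.+1%:R^-1.
(* [F] enumerates the null rational balls; every other index gets the empty set. *)
pose F (j : nat) : set (BorelRn R n) :=
  if unpickle j is Some qk then (if mu (b qk) == 0%E then b qk else set0)
  else set0.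
have mb qk : measurable (b qk) by apply: sub_sigma_algebra; exact: ball_open.
have /negligible_bigcup FN : forall j, mu.-negligible (F j).
  move=> j; rewrite /F; case: unpickle => [qk|]; last exact: negligible_set0.
  case: ifPn => [/eqP b0|_]; last exact: negligible_set0.
  by exists (b qk); split.
have mKC : measurable (~` K : set (BorelRn R n)) by exact: sub_sigma_algebra.
apply/(negligibleP mu mKC); apply: negligibleS FN => x Kx.
have /existsNP[B /not_implyP[oB /not_implyP[Bx muB]]] : ~ msupport mu x.
  by move=> /suppK.
have [q [k [qx qB]]] := rational_ball _ _ _ _ oB Bx.
exists (pickle (q, k)) => //; rewrite /F pickleK ifT //.
rewrite eq_le measure_ge0 andbT; have /negP := muB; rewrite -leNgt.
apply: le_trans; apply: le_measure => //; rewrite inE; first exact: mb.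
exact: sub_sigma_algebra.
Qed.

Section pairing_integral.
(* Activates the canonical instances on multinomials without their notations,
   which clash with those of MathComp-Analysis. *)
Import -(notations) mpoly.

Lemma pairing_integral (R : realType) (n : nat) (mu : {measure set (BorelRn R n) -> \bar R})
    (p : mpoly.mpoly n R) (d : nat) (y : mpoly.multinom n -> R) :
  (pdeg p <= d)%N ->
  (forall a : mpoly.multinom n, (mpoly.mdeg a <= d)%N ->
      mu.-integrable setT (fun x : BorelRn R n => (mono a x)%:E) /\
      (y a)%:E = (\int[mu]_(x in setT) (mono a x)%:E)%E) ->
  mu.-integrable setT (fun x : BorelRn R n => (peval p x)%:E) /\
  (\int[mu]_(x in setT) (peval p x)%:E)%E = (pairing p y)%:E.
Proof.
move=> pd yE.
have dega (a : mpoly.multinom n) : a \in mpoly.msupp p -> (mpoly.mdeg a <= d)%N.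
  move=> ap; apply: leq_trans pd; rewrite /pdeg.
  by rewrite (big_rem _ ap) /= leq_max leqnn.
have pE : (fun x : BorelRn R n => (peval p x)%:E) = (fun x : BorelRn R n =>
    \sum_(a <- mpoly.msupp p) (mpoly.mcoeff a p)%:E * (mono a x)%:E)%E.
  apply/funext => x; rewrite /peval mpoly.mevalE sumEFin; congr EFin.
  by apply: eq_bigr => a _; rewrite /mono /peval mpoly.mevalX.
(* Outside the support of [p] the coefficient is 0, so nothing is asked of monomials of degree above
   [d]. *)
have intE (a : mpoly.multinom n) : mu.-integrable setT
    (fun x : BorelRn R n => (mpoly.mcoeff a p)%:E * (mono a x)%:E)%E.
  have [ap|/mpoly.memN_msupp_eq0 ->] := boolP (a \in mpoly.msupp p).
    by apply: integrableZl => //; have [] := yE _ (dega _ ap).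
  by under eq_fun do rewrite mul0e; exact: integrable0.
rewrite pE; split; first exact: integrable_sum.
rewrite integral_sum //= /pairing -sumEFin big_seq [in RHS]big_seq.
apply: eq_bigr => a /dega /yE[inta ya].
by rewrite integralZl // -ya EFinM.
Qed.

End pairing_integral.

(** * Separation of a point from an upward closed convex set *)

(** First-order optimality condition for a squared distance along a segment. *)
Lemma quadratic_ge0_slope (R : realType) (a S : R) : 0 <= S ->
  (forall t, 0 < t -> t <= 1 -> 0 <= 2 * t * a + t ^+ 2 * S) -> 0 <= a.
Proof.
move=> S0 h; rewrite leNgt; apply/negP => a0.
have Sa : 0 < S - a by lra.
(* Chosen so that [t * S <= - a], whence [2 * a + t * S <= a < 0]. *)
pose t := - a / (S - a).
have t0 : 0 < t by rewrite divr_gt0 // oppr_gt0.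
have t1 : t <= 1 by rewrite ler_pdivrMr //; lra.
have tS : t * S <= - a.
  rewrite -[leRHS]mulr1 /t -mulrA ler_wpM2l //; first by lra.
  by rewrite mulrC ler_pdivrMr //; lra.
have := h _ t0 t1.
have -> : 2 * t * a + t ^+ 2 * S = t * (2 * a + t * S) by ring.
by rewrite pmulr_rge0 //; lra.
Qed.

Definition upward_closed {R : realType} {m : nat} (C : set 'rV[R]_m) :=
  forall u w : 'rV[R]_m, C u -> (forall i, u ord0 i <= w ord0 i) -> C w.

(* The set [D] below is the closure of [C], written so that its convexity is
   immediate; [lambda] is the difference between the Euclidean projection of
   [v - e] onto [D] and [v - e]. *)
Lemma upward_closed_separation (R : realType) (m : nat) (C : set 'rV[R]_m)
    (v : 'rV[R]_m) (e : R) :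
  is_convex C -> upward_closed C -> C !=set0 -> 0 < e -> ~ C v ->
  exists l : 'I_m -> R, [/\ forall i, 0 <= l i, exists i, 0 < l i &
    forall u, C u -> \sum_i l i * (v ord0 i - e) <= \sum_i l i * u ord0 i].
Proof.
move=> cvxC upC [w0 Cw0] e0 Cv.
pose D : set 'rV[R]_m := [set u | forall r, 0 < r -> C (u + const_mx r)].
have CD u : C u -> D u.
  by move=> Cu r r0; apply: upC Cu _ => i; rewrite !mxE; lra.
have cvxD : is_convex D.
  move=> a b t Da Db t0 t1 r r0; have := cvxC _ _ _ (Da _ r0) (Db _ r0) t0 t1.
  by congr C; apply/rowP => i; rewrite !mxE; ring.
have upD : upward_closed D.
  move=> u w Du uw r /Du Cu; apply: upC Cu _ => i.
  by rewrite !mxE; have := uw i; lra.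
have clD : closed D.
  move=> u clDu r r0.
  have r20 : 0 < r / 2 by lra.
  have [w [Dw /ball_rVP-/(_ r20) uw]] := clDu _ (nbhsx_ballx u _ r20).
  apply: upC (Dw _ r20) _ => i; have := uw i.
  by rewrite !mxE ltr_norml => /andP[? ?]; lra.
pose q : 'rV[R]_m := v - const_mx e.
have Dq : ~ D q by move=> /(_ _ e0); rewrite /q subrK.
pose g (u : 'rV[R]_m) : R := \sum_i (u ord0 i - q ord0 i) ^+ 2.
have cg : continuous g.
  apply: continuous_big => [|i _]; first exact: add_continuous.
  move=> u; apply: (@continuous_comp _ _ _ (fun u : 'rV[R]_m => u ord0 i - q ord0 i : R)
    (fun t : R => t ^+ 2)); last exact: exprn_continuous.
  apply: continuousB; [exact: coord_continuous|exact: cst_continuous].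
(* Cutting [D] by a sublevel set of [g] gives a compact set, on which [g] attains its minimum. *)
pose A := D `&` [set u | g u <= g w0].
have A0 : A !=set0 by exists w0; split; [exact: CD|exact: lexx].
have clA : closed A.
  apply: closedI => //.
  apply: (preimage_closed (f := g) (D := [set t | t <= g w0])).
    by move=> ? _; exact: cg.
  exact: closed_le.
have bA : bounded_set A.
  (* The radius [g w0 + 1] avoids a square root: [a ^+ 2 <= s] implies [|a| < s + 1]. *)
  exists (`|q| + (g w0 + 1)); split; first exact: num_real.
  move=> N qN u [_ /= gu]; apply: le_trans (ltW qN).
  have gw1 : 0 < g w0 + 1.
    by apply: ltr_wpDl => //; apply: sumr_ge0 => i _; exact: sqr_ge0.
  have : ball q (g w0 + 1) u.
    apply/ball_rVP => // i.
    have gi : (u ord0 i - q ord0 i) ^+ 2 <= g w0.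
      apply: le_trans gu; rewrite /g (bigD1 i) //= lerDl.
      by apply: sumr_ge0 => j _; exact: sqr_ge0.
    by rewrite ltr_norml; apply/andP; split; nra.
  rewrite -ball_normE /= => /ltW qu.
  have -> : u = q - (q - u) by rewrite opprB addrC subrK.
  by apply: le_trans (ler_normB _ _) _; rewrite lerD2l.
have cA : compact A by exact: bounded_closed_compact.
have [p /[1!inE] -[Dp gp] pmin] : exists2 c, c \in A & forall t, t \in A -> g c <= g t.
  by apply: EVT_min_rV => //; exact: continuous_subspaceT.
have {}pmin u : D u -> g p <= g u.
  move=> Du; have [gu|/ltW gu] := leP (g u) (g w0); last exact: le_trans gp gu.
  by apply: pmin; rewrite inE.
pose l i := p ord0 i - q ord0 i.
have varineq u : D u -> 0 <= \sum_i l i * (u ord0 i - p ord0 i).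
  move=> Du; apply: (@quadratic_ge0_slope _ _ (\sum_i (u ord0 i - p ord0 i) ^+ 2)).
    by apply: sumr_ge0 => i _; exact: sqr_ge0.
  (* Minimality of [p] against [t *: u + (1 - t) *: p]; the difference of the values of [g] is a
     quadratic in [t]. *)
  move=> t t0 t1; have /pmin := cvxD _ _ _ Du Dp (ltW t0) t1.
  rewrite -subr_ge0 /g -sumrB !mulr_sumr -big_split /=.
  congr (_ <= _); apply: eq_bigr => i _; rewrite /l !mxE; ring.
have l0 i : 0 <= l i.
  (* Upward closedness allows a unit step from [p] along coordinate [i]. *)
  have /varineq : D (p + delta_mx ord0 i).
    by apply: upD Dp _ => j; rewrite !mxE lerDl; case: (_ && _).
  rewrite (bigD1 i) //= big1 ?addr0 => [|j /negbTE ji].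
    by rewrite !mxE !eqxx /= addrAC subrr add0r mulr1.
  by rewrite !mxE ji andbF /= addr0 subrr mulr0.
exists l; split=> //.
  apply: contrapT => /forallNP lN; apply: Dq; suff <- : p = q by [].
  apply/rowP => i; have := l0 i; have := lN i; rewrite /l => /negP; rewrite -leNgt; lra.
move=> u /CD /varineq.
(* The pairing of [l] with [u - q] is its pairing with [u - p] plus the squared length of [l]. *)
have : 0 <= \sum_i l i ^+ 2 by apply: sumr_ge0 => i _; exact: sqr_ge0.
move=> h1 h2; rewrite -subr_ge0 -sumrB.
have := addr_ge0 h1 h2; rewrite -big_split /=.
by congr (_ <= _); apply: eq_bigr => i _; rewrite /l !mxE; ring.
Qed.

(** * Convex hulls *)

Lemma convhull_convex (R : realType) (m : nat) (A : set 'rV[R]_m) :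
  is_convex (convhull A).
Proof.
move=> a b t [k1 [w1 [p1 [w10 [w11 [Ap1 ->]]]]]] [k2 [w2 [p2 [w20 [w21 [Ap2 ->]]]]]] t0 t1.
exists (k1 + k2)%N.
exists (fun j => match fintype.split j with inl j => t * w1 j | inr j => (1 - t) * w2 j end).
exists (fun j => match fintype.split j with inl j => p1 j | inr j => p2 j end).
split; [|split; [|split]].
- by move=> j; case: fintype.split => i; rewrite mulr_ge0 // subr_ge0.
- rewrite big_split_ord /=.
  under eq_bigr => j _ do rewrite (unsplitK (inl j)).
  under [X in _ + X]eq_bigr => j _ do rewrite (unsplitK (inr j)).
  by rewrite -!mulr_sumr w11 w21; ring.
- by move=> j; case: fintype.split.
- rewrite big_split_ord /=.
  under [X in _ = X + _]eq_bigr => j _ do rewrite (unsplitK (inl j)) -scalerA.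
  under [X in _ = _ + X]eq_bigr => j _ do rewrite (unsplitK (inr j)) -scalerA.
  by rewrite -!scaler_sumr.
Qed.

Lemma sub_convhull (R : realType) (m : nat) (A : set 'rV[R]_m) :
  A `<=` convhull A.
Proof.
move=> a Aa; exists 1%N, (fun=> 1), (fun=> a).
by rewrite !big_ord1 scale1r.
Qed.

(** Since the weights sum to 1, translating every point by [w - u] translates the combination from
    [u] to [w]. *)
Lemma upward_closed_convhull (R : realType) (m : nat) (A : set 'rV[R]_m) :
  upward_closed A -> upward_closed (convhull A).
Proof.
move=> upA u w [k [c [p [c0 [c1 [Ap ->]]]]]].
set s := \sum_j _ => sw.
exists k, c, (fun j => p j + (w - s)); split=> //; split=> //; split.
  by move=> j; apply: upA (Ap j) _ => i; rewrite !mxE lerDl subr_ge0; exact: sw.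
under eq_bigr do rewrite scalerDr.
by rewrite big_split /= -scaler_suml c1 scale1r addrC subrK.
Qed.

(** Induction on the number of points: the first is split off, and the other weights are rescaled by
    their sum [s], unless [s = 0], when they all vanish. *)
Lemma convhull_id (R : realType) (m : nat) (A : set 'rV[R]_m) :
  is_convex A -> convhull A = A.
Proof.
move=> cvxA; apply/seteqP; split; last exact: sub_convhull.
move=> _ [k [w [p [w0 [w1 [Ap ->]]]]]].
elim: k w p w0 w1 Ap => [|k IH] w p w0 w1 Ap.
  by move: w1; rewrite big_ord0 => /eqP; rewrite eq_sym oner_eq0.
rewrite big_ord_recl /=; rewrite big_ord_recl /= in w1.
set s := \sum_(i < k) w (lift ord0 i) in w1.
have s0 : 0 <= s by apply: sumr_ge0.
have [s_eq0|s_neq0] := eqVneq s 0.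
  rewrite big1 => [|i _]; last first.
    have /eqP := s_eq0; rewrite psumr_eq0 => [/allP/(_ i)|//].
    by rewrite mem_index_enum => /(_ isT)/eqP ->; rewrite scale0r.
  by rewrite s_eq0 addr0 in w1; rewrite w1 scale1r addr0.
have Aq : A (\sum_(i < k) (w (lift ord0 i) / s) *: p (lift ord0 i)).
  by apply: IH => // [j|]; [rewrite divr_ge0|rewrite -mulr_suml divff].
have w01 : w ord0 <= 1 by rewrite -w1 lerDl.
have := cvxA _ _ _ (Ap ord0) Aq (w0 _) w01.
have -> : 1 - w ord0 = s by rewrite -w1 addrAC subrr add0r.
congr (A (_ + _)); rewrite scaler_sumr; apply: eq_bigr => i _.
by rewrite scalerA mulrCA divff // mulr1.
Qed.

(** * Finitely atomic measures and their moments *)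

Lemma integral_atomic (d : measure_display) (T : measurableType d) (R : realType)
    (W : nat -> {nonneg R}) (X : nat -> T) (k : nat) (g : T -> R) :
  measurable_fun setT g ->
  let mu := msum (fun j => mscale (W j) \d_(X j)) k in
  mu.-integrable setT (EFin \o g) /\
  (\int[mu]_x (g x)%:E)%E = (\sum_(j < k) (W j)%:num * g (X j))%:E.
Proof.
move=> mg mu.
(* The formula is proved for nonnegative functions, then applied to [|g|] for integrability and to
   the positive and negative parts of [g]. *)
have ge0E (h : T -> \bar R) : measurable_fun setT h -> (forall x, 0 <= h x)%E ->
    (\int[mu]_x h x = \sum_(j < k) (W j)%:num%:E * h (X j))%E.
  move=> mh h0; rewrite ge0_integral_measure_sum //.
  apply: eq_bigr => j _; rewrite ge0_integral_mscale // integral_dirac //.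
  by rewrite diracT mul1e.
have mgE : measurable_fun setT (EFin \o g) by exact/measurable_EFinP.
split.
  apply/integrableP; split=> //; rewrite ge0E //; last exact: measurableT_comp.
  by under eq_bigr do rewrite /= -EFinM; rewrite sumEFin ltry.
rewrite integralE ge0E //; last exact: measurable_funepos.
rewrite ge0E //; last exact: measurable_funeneg.
under eq_bigr do rewrite funeposE /= -EFin_max -EFinM.
under [X in (_ - X)%E]eq_bigr do rewrite funenegE /= -EFin_max -EFinM.
rewrite !sumEFin -EFinB -sumrB; congr EFin; apply: eq_bigr => j _.
by rewrite -mulrBr; congr (_ * _); rewrite /Num.max; case: ifP; case: ifP; lra.
Qed.

Lemma in_moment_cone_atomic (R : realType) (n k d : nat) (K : set 'rV[R]_n)
    (w : 'I_k -> R) (x : 'I_k -> 'rV[R]_n) :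
  closed K -> (forall j, 0 <= w j) -> (forall j, K (x j)) ->
  in_moment_cone K d (fun a => \sum_j w j * mono a (x j)).
Proof.
move=> clK w0 Kx.
(* [msum] takes a family indexed by [nat], so weights and points are extended by 0 from index [k]
   on. *)
have W0 (j : nat) : 0 <= oapp w 0 (insub j) by case: insub => /=.
pose W (j : nat) : {nonneg R} := NngNum (W0 j).
pose X (j : nat) : BorelRn R n := oapp x 0 (insub j).
exists (msum (fun j => mscale (W j) \d_(X j)) k); split.
  move=> z suppz; apply: contrapT => Kz.
  (* The complement of [K] is an open neighbourhood of [z] containing no atom. *)
  have := suppz _ (closed_openC clK) Kz; rewrite /= /msum big1 ?ltxx // => j _.
  rewrite /= /mscale /= /X valK /= diracE memNset ?mule0 //.
  by move=> /(_ (Kx j)).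
move=> a _.
have [|int_a ->] := @integral_atomic _ (BorelRn R n) R W X k (mono a).
  by apply: measurable_fun_continuous; exact: continuous_peval.
by split=> //; congr EFin; apply: eq_bigr => j _; rewrite /= /X valK.
Qed.

Lemma pairing_atomic (R : realType) (n k : nat) (p : mpoly.mpoly n R)
    (w : 'I_k -> R) (x : 'I_k -> 'rV[R]_n) :
  pairing p (fun a => \sum_j w j * mono a (x j)) = \sum_j w j * peval p (x j).
Proof.
rewrite /pairing; under eq_bigr do rewrite mulr_sumr.
rewrite exchange_big /=; apply: eq_bigr => j _.
rewrite /peval mpoly.mevalE mulr_sumr; apply: eq_bigr => a _.
by rewrite /mono /peval mpoly.mevalX mulrCA.
Qed.

Lemma mono0 (R : realType) (n : nat) (x : 'rV[R]_n) : mono (@mpoly.mnm0 n) x = 1.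
Proof.
rewrite /mono /peval mpoly.mevalX big1 // => i _.
by rewrite mpoly.mnmE expr0.
Qed.

(** * Comparison of [Vset] with the convex hull of [Uset] *)

Lemma upward_closed_Uset (R : realType) (n m : nat) (K : set 'rV[R]_n)
    (f : 'I_m -> mpoly.mpoly n R) : upward_closed (Uset K f).
Proof.
by move=> u w [x Kx xu] uw; exists x => // i; exact: le_trans (xu i) (uw i).
Qed.

(** Each [p j] dominates the values of [f] at some [x j] in [K]; the moments of the measure with
    mass [w j] at [x j] are the required [y]. *)
Lemma convhull_Uset_lt_Vset (R : realType) (n m : nat) (K : set 'rV[R]_n)
    (f : 'I_m -> mpoly.mpoly n R) (u v : 'rV[R]_m) : closed K ->
  convhull (Uset K f) u -> (forall i, u ord0 i < v ord0 i) -> Vset K f v.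
Proof.
move=> clK [k [w [p [w0 [w1 [Up ->]]]]]] uv.
have xP j : exists x, K x /\ forall i, peval (f i) x <= p j ord0 i.
  by have [x Kx xp] := Up j; exists x.
pose x j := projT1 (cid (xP j)).
have Kx j : K (x j) by have [] := projT2 (cid (xP j)).
have xp j i : peval (f i) (x j) <= p j ord0 i.
  by have [_] := projT2 (cid (xP j)); exact.
exists (fun a => \sum_j w j * mono a (x j)); split.
  exact: in_moment_cone_atomic.
split; first by under eq_bigr do rewrite mono0 mulr1.
move=> i; rewrite pairing_atomic; apply: le_lt_trans (uv i).
rewrite summxE; apply: ler_sum => j _; rewrite mxE.
exact: ler_wpM2l.
Qed.

(** The same [y] serves for all [w], as the finitely many strict inequalities leave a common
    margin. *)
Lemma Vset_lower_slack (R : realType) (n m : nat) (K : set 'rV[R]_n)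
    (f : 'I_m -> mpoly.mpoly n R) (v : 'rV[R]_m) : Vset K f v ->
  exists2 e, 0 < e & forall w : 'rV[R]_m,
    (forall i, v ord0 i - e <= w ord0 i) -> Vset K f w.
Proof.
move=> [y [Ky [y0 yv]]]; have [e e0 ye] := uniform_gap _ _ _ _ yv.
exists e => // w vw; exists y; split=> //; split=> // i.
by have := ye i; have := vw i; lra.
Qed.

Lemma open_Vset (R : realType) (n m : nat) (K : set 'rV[R]_n)
    (f : 'I_m -> mpoly.mpoly n R) : open (Vset K f).
Proof.
rewrite openE => v /Vset_lower_slack[e e0 ve].
apply/nbhs_ballP; exists e => // w /ball_rVP-/(_ e0) vw; apply: ve => i.
by have := vw i; rewrite ltr_norml => /andP[? ?]; lra.
Qed.

(* If [v] were not in the convex hull, a separating functional [l >= 0] would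
   make [sum_i l_i (f_i - v_i + e)] nonnegative on [K], but its integral is
   negative. *)
Lemma Vset_sub_convhull (R : realType) (n m : nat) (K : set 'rV[R]_n)
    (f : 'I_m -> mpoly.mpoly n R) : closed K -> K !=set0 ->
  Vset K f `<=` convhull (Uset K f).
Proof.
move=> clK [x0 Kx0] v [y [[mu [suppK muy]] [y0 yv]]]; apply: contrapT => Cv.
have [e e0 ye] := uniform_gap _ _ _ _ yv.
have Kf x : K x -> convhull (Uset K f) (\row_i peval (f i) x).
  by move=> Kx; apply: sub_convhull; exists x => // i; rewrite mxE.
have [l [l0 [i0 li0] lC]] := upward_closed_separation _ _ _ _ _
  (convhull_convex _ _ _) (upward_closed_convhull _ _ _ (upward_closed_Uset _ _ _ _ _))
  (ex_intro _ _ (Kf _ Kx0)) e0 Cv.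
set s := \sum_i l i * (v ord0 i - e) in lC.
have fint i : mu.-integrable setT (fun x : BorelRn R n => (peval (f i) x)%:E) /\
    (\int[mu]_x (peval (f i) x)%:E)%E = (pairing (f i) y)%:E.
  by apply: pairing_integral muy; exact: (leq_bigmax i).
have [int1 muT] := muy (@mpoly.mnm0 n) (leq_trans (eq_leq mpoly.mdeg0) (leq0n _)).
pose h1 (x : BorelRn R n) : \bar R := (\sum_i (l i)%:E * (peval (f i) x)%:E)%E.
(* The constant [- s] is written as a multiple of the monomial 1, whose integral is [y_0 = 1]. *)
pose h2 (x : BorelRn R n) : \bar R := ((- s)%:E * (mono (@mpoly.mnm0 n) x)%:E)%E.
have lfint i : mu.-integrable setT
    (fun x : BorelRn R n => (l i)%:E * (peval (f i) x)%:E)%E.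
  by apply: integrableZl => //; have [] := fint i.
have ih1 : mu.-integrable setT h1 by exact: integrable_sum.
have ih2 : mu.-integrable setT h2 by exact: integrableZl.
have ih : mu.-integrable setT (h1 \+ h2)%E by exact: integrableD.
have hE : (\int[mu]_x (h1 x + h2 x))%E = (\sum_i l i * pairing (f i) y - s)%:E.
  rewrite integralD // integral_sum //= integralZl // -muT y0 mule1 EFinD -sumEFin.
  congr (_ + _)%E; apply: eq_bigr => i _.
  by have [inti fiE] := fint i; rewrite integralZl // fiE EFinM.
have mKC : measurable (~` K : set (BorelRn R n)).
  by apply: sub_sigma_algebra; exact: closed_openC.
have : (0 <= \int[mu]_x (h1 x + h2 x))%E.
  rewrite (negligible_integral mKC) //; last exact: measure_setC_msupport.
  apply: integral_ge0 => x [_ /contrapT Kx].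
  rewrite /h1 /h2 mono0 mule1; under eq_bigr do rewrite -EFinM.
  rewrite sumEFin -EFinD lee_fin subr_ge0.
  have := lC _ (Kf _ Kx); congr (_ <= _).
  by apply: eq_bigr => i _; rewrite mxE.
rewrite hE lee_fin subr_ge0 leNgt => /negP; apply.
(* The index [i0] with [0 < l i0] makes the inequality strict. *)
rewrite -subr_gt0 /s -sumrB (bigD1 i0) //=.
have lt i : pairing (f i) y < v ord0 i - e by have := ye i; lra.
apply: ltr_pwDl; first by rewrite -mulrBr mulr_gt0 // subr_gt0.
by apply: sumr_ge0 => i _; rewrite -mulrBr mulr_ge0 // subr_ge0 ltW.
Qed.

Lemma interior_convhull_Uset (R : realType) (n m : nat) (K : set 'rV[R]_n)
    (f : 'I_m -> mpoly.mpoly n R) : closed K -> K !=set0 ->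
  interior (convhull (Uset K f)) = Vset K f.
Proof.
move=> clK K0; apply/seteqP; split=> v.
  move=> /nbhs_ballP[e /= e0 eC].
  (* Lowering all coordinates of [v] by [e / 2] stays inside the ball. *)
  apply: (convhull_Uset_lt_Vset _ _ _ _ _ (v - const_mx (e / 2))) => //.
    apply: eC; apply/ball_rVP => // i; rewrite !mxE opprB addrC subrK ger0_norm; lra.
  by move=> i; rewrite !mxE; lra.
have : Vset K f `<=` interior (convhull (Uset K f)).
  by rewrite -open_subsetE; [exact: Vset_sub_convhull|exact: open_Vset].
exact.
Qed.

Theorem theorem3p2 (R : realType) (n m nE nI : nat)
  (f : 'I_m -> mpoly.mpoly n R)
  (cE : 'I_nE -> mpoly.mpoly n R) (cI : 'I_nI -> mpoly.mpoly n R) :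
  interior (Kset cE cI) !=set0 ->
  interior (convhull (Uset (Kset cE cI) f)) = Vset (Kset cE cI) f /\
  (is_convex (Uset (Kset cE cI) f) ->
   forall v : 'rV[R]_m, fimage (Kset cE cI) f v ->
     (weakly_pareto_value (Kset cE cI) f v <->
      boundary (closure (Vset (Kset cE cI) f)) v)).
Proof.
have clK := closed_Kset _ _ _ _ cE cI; move: (Kset cE cI) clK => K clK.
move=> [x0 /interior_subset Kx0].
have K0 : K !=set0 by exists x0.
split; first exact: interior_convhull_Uset.
move=> cvxU v [x Kx vE].
have ltV z (w : 'rV[R]_m) : K z -> (forall i, peval (f i) z < w ord0 i) -> Vset K f w.
  move=> Kz zw; apply: (convhull_Uset_lt_Vset _ _ _ _ _ (\row_i peval (f i) z)) => //.
    by apply: sub_convhull; exists z => // i; rewrite mxE.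
  by move=> i; rewrite mxE.
split=> [[xs [[Kxs xsP] {vE}vE]]|[_ vN]].
  split.
    (* Points slightly above [v] on the diagonal lie in [Vset K f]. *)
    apply: subset_closure => B /nbhs_ballP[e /= e0 eB].
    exists (v + const_mx (e / 2)); split.
      by apply: (ltV xs) => // i; rewrite vE !mxE; lra.
    by apply: eB; apply/ball_rVP => // i; rewrite !mxE opprD addrA subrr sub0r normrN ger0_norm; lra.
  move=> /nbhs_ballP[e /= e0 eV]; apply: xsP.
  have e20 : 0 < e / 2 by lra.
  (* Some [w] in [Vset K f] is within [e / 2] of this lowered point, hence strictly below [v]; as
     [w] is in the convex set [Uset K f], this contradicts weak Pareto optimality. *)
  have : closure (Vset K f) (v - const_mx (e / 2)).
    by apply: eV; apply/ball_rVP => // i; rewrite !mxE opprB addrC subrK ger0_norm; lra.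
  move=> /(_ _ (nbhsx_ballx _ _ e20))[w [Vw /ball_rVP-/(_ e20) vw]].
  have := Vset_sub_convhull _ _ _ _ _ clK K0 _ Vw; rewrite convhull_id //.
  move=> [z Kz zw]; exists z => // i; apply: le_lt_trans (zw i) _.
  by have := vw i; rewrite vE !mxE ltr_norml => /andP[? ?]; lra.
exists x; split=> //; split=> // -[z Kz zx]; apply: vN.
(* A point [z] strictly better than [x] would put [v] in the open set [Vset K f], hence in the
   interior of its closure. *)
have VV : Vset K f `<=` interior (closure (Vset K f)).
  by rewrite -open_subsetE; [exact: subset_closure|exact: open_Vset].
by apply/VV/(ltV z) => // i; rewrite vE mxE.
Qed.
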